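(* Let $m,r,t\geq 2$ be integers and let $C_{m,r}$ be a cycle poset. Then $$\operatorname{height}(I_t(C_{m,r}))=\begin{cases}\frac{m+r}{t}-1, & \text{if } t \text{ divides both } m \text{ and } r;\\ \lfloor\frac{m}{t}\rfloor+\lfloor\frac{r}{t}\rfloor, & \text{otherwise.}\end{cases}$$
   Context: The cycle poset $C_{m,r}$ is the poset having exactly two maximal saturated chains $x_{i_1}<\cdots<x_{i_m}$ and $x_{j_1}<\cdots<x_{j_r}$, with $m$ and $r$ elements respectively, where $x_{i_1}=x_{j_1}$, $x_{i_m}=x_{j_r}$ and the two chains have no other elements in common; its cover relations are exactly the consecutive relations in these two chains, so that its Hasse diagram is a cycle as an undirected graph (in the degenerate case $m=r=2$ the two chains coincide and $C_{2,2}$ is the two-element chain). A path of length $t$ in a poset $P$ is a saturated chain of $t$ elements (each element covers the previous one). Identify the elements of $P$ with the variables of a polynomial ring $S$ over an arbitrary field $k$; the path ideal $I_t(P)\subseteq S$ is generated by the monomials $x_{l_1}\cdots x_{l_t}$ where $x_{l_1},\ldots,x_{l_t}$ runs over the paths of length $t$ in $P$. *)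

(* Defs.v *)
From HB Require Import structures.
From mathcomp Require Import all_boot all_order all_algebra.
From mathcomp Require Export mpoly.

Set Implicit Arguments.
Unset Strict Implicit.
Unset Printing Implicit Defensive.

Import Order.TTheory GRing.Theory.

Section Posets.
Variables (d : Order.disp_t) (P : finPOrderType d).
Implicit Types (x y z : P) (s : seq P).
Local Open Scope order_scope.

(* y covers x *)
Definition covers x y : bool :=
  (x < y) && [forall z, ~~ ((x < z) && (z < y))].

Definition saturated_chain s : bool := sorted covers s.

Definition maximal_saturated_chain s : Prop :=
  saturated_chain s /\
  forall s', saturated_chain s' -> {subset s <= s'} -> s' = s.

(* P is a cycle poset C_{m,r}: its maximal saturated chains are c1 and c2,
   which share their end points b and e and nothing else.  The conditions force
   c1 != c2 unless m = r = 2, and no poset satisfies them when exactly one of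
   m and r is 2, as b < e would then not be a cover relation. *)
Definition cycle_poset (m r : nat) : Prop :=
  exists (b e : P) (s1 s2 : seq P),
    let c1 := b :: rcons s1 e in
    let c2 := b :: rcons s2 e in
    [/\ size c1 = m /\ size c2 = r,
        ~~ has (mem s1) s2,
        forall s, maximal_saturated_chain s <-> s = c1 \/ s = c2 &
        forall x y, covers x y = infix [:: x; y] c1 || infix [:: x; y] c2].

End Posets.

Section Ideals.
Variable R : comNzRingType.
Implicit Types (I : R -> Prop) (p : {pred R}).
Local Open Scope ring_scope.

Definition generated_ideal (G : R -> Prop) (f : R) : Prop :=
  exists (n : nat) (a g : 'I_n -> R),
    (forall i, G (g i)) /\ f = \sum_(i < n) a i * g i.

(* idealr_closed includes properness.  Classically, every subset of R is given
   by a boolean predicate, so no ideal is lost by using the library notion. *)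
Definition prime_ideal p : Prop := idealr_closed p /\ prime_idealr_closed p.

(* There is a chain of primes q_0 < q_1 < ... < q_h = p. *)
Definition prime_chain_below p (h : nat) : Prop :=
  exists q : nat -> {pred R},
    [/\ forall i, (i <= h)%N -> prime_ideal (q i),
        forall i, (i < h)%N ->
          {subset q i <= q i.+1} /\ ~ {subset q i.+1 <= q i} &
        q h =i p].

Definition prime_height p (h : nat) : Prop :=
  prime_chain_below p h /\
  forall h', prime_chain_below p h' -> (h' <= h)%N.

Definition prime_over I p : Prop :=
  prime_ideal p /\ forall f, I f -> f \in p.

(* height I h means that h is the minimum of the heights of the primes
   containing I.  In the second conjunct, a prime of infinite height counts as
   having height at least h. *)
Definition height I (h : nat) : Prop :=
  (exists p, prime_over I p /\ prime_height p h) /\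
  (forall p, prime_over I p -> prime_chain_below p h).

End Ideals.

Section PathIdeals.
Variables (k : fieldType) (d : Order.disp_t) (P : finPOrderType d).
Local Open Scope ring_scope.

(* The variable of the polynomial ring identified with the element x of P. *)
Definition var (x : P) : {mpoly k[#|P|]} := 'X_(enum_rank x).

Definition path_ideal (t : nat) : {mpoly k[#|P|]} -> Prop :=
  generated_ideal (fun f => exists s : seq P,
    [/\ size s = t, saturated_chain s & f = \prod_(x <- s) var x]).

End PathIdeals.

(* Main.v *)
(* The height of a path ideal is the least number of elements of the poset meeting
   every path of length t: a prime containing the ideal contains the variables of
   such a hitting set, and the prime generated by a set A of variables has height
   #|A|.  The upper bound in the latter follows from dim k[x_1..x_n] <= n, which
   is proved in the style of Coquand and Lombardi: given primes q_0 < ... < q_l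
   and f_i in q_(i+1) but not in q_i, a nontrivial algebraic relation among the f_i
   would, starting from its lexicographically smallest monomial, force a nonzero
   constant into q_l; and n + 1 polynomials in n variables are always related.

   In the cycle poset, the elements whose position in one of the two maximal
   chains is a multiple of t form a hitting set, and the common maximum is counted
   twice exactly when t divides both m and r.  Conversely a chain of n elements
   contains n %/ t disjoint paths; applying this to the two maximal chains with
   zero, one or both end points removed, according to which end points belong to
   the hitting set, gives the lower bound. *)

Require Import Defs.
From Stdlib Require Import Classical.
From mathcomp Require Import all_boot all_order all_algebra.
From mathcomp Require Import zify.

Set Implicit Arguments.
Unset Strict Implicit.
Unset Printing Implicit Defensive.

Import Order.TTheory GRing.Theory.
Local Open Scope ring_scope.

(** * Krull dimension of polynomial rings *)

Section PrimeIdeals.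
Variables (R : comNzRingType) (p : {pred R}).
Hypothesis prime_p : prime_ideal p.

Lemma prime_ideal0 : 0 \in p.
Proof. by case: prime_p => -[]. Qed.

Lemma prime_ideal1 : 1 \notin p.
Proof. by case: prime_p => -[]. Qed.

Lemma prime_idealMl a x : x \in p -> a * x \in p.
Proof.
by case: prime_p => -[p0 _ pD] _ px; rewrite -[a * x]addr0 pD.
Qed.

Lemma prime_idealD x y : x \in p -> y \in p -> x + y \in p.
Proof. by case: prime_p => -[_ _ pD] _ px py; rewrite -[x]mul1r pD. Qed.

Lemma prime_idealB x y : x \in p -> y \in p -> x - y \in p.
Proof. by move=> px py; rewrite -mulN1r prime_idealD ?prime_idealMl. Qed.

Lemma prime_ideal_sum (I : Type) (s : seq I) (Q : pred I) (F : I -> R) :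
  (forall i, Q i -> F i \in p) -> \sum_(i <- s | Q i) F i \in p.
Proof.
move=> pF; apply: (big_ind (fun x => x \in p)) => //.
  exact: prime_ideal0.
exact: prime_idealD.
Qed.

Lemma prime_idealX_cancel x y n : x \notin p -> x ^+ n * y \in p -> y \in p.
Proof.
move=> px; elim: n => [|n IHn]; first by rewrite mul1r.
rewrite exprS -mulrA => /(proj2 prime_p); rewrite (negPf px); exact: IHn.
Qed.

Lemma prime_ideal_prod (I : eqType) (s : seq I) (F : I -> R) :
  \prod_(i <- s) F i \in p -> exists2 i, i \in s & F i \in p.
Proof.
elim: s => [|i s IHs]; first by rewrite big_nil (negPf prime_ideal1).
rewrite big_cons => /(proj2 prime_p)/orP[pi|/IHs[j js pj]].
  by exists i; rewrite ?mem_head.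
by exists j; rewrite // inE js orbT.
Qed.

End PrimeIdeals.

Lemma prime_chain_independent (k : fieldType) (R : comAlgType k) (l : nat)
    (q : nat -> {pred R}) (f : 'I_l -> R) (D : nat)
    (c : {ffun 'I_l -> 'I_D} -> k) :
  (forall i, (i <= l)%N -> prime_ideal (q i)) ->
  (forall i, (i < l)%N -> {subset q i <= q i.+1}) ->
  (forall i : 'I_l, f i \notin q i) -> (forall i : 'I_l, f i \in q i.+1) ->
  \sum_a c a *: \prod_i f i ^+ a i \in q 0 -> forall a, c a = 0.
Proof.
move=> q_prime q_sub fNq fq sum_q a1; apply/eqP/negPn/negP => ca1.
(* Keep only the monomials that are lexicographically smallest in the first j
   exponents; cancelling powers of f_0, ..., f_(j-1) puts what is left in q_j. *)
have step j : (j <= l)%N -> exists A : {set {ffun 'I_l -> 'I_D}},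
    [/\ A != set0, forall a, a \in A -> c a != 0,
        forall a b, a \in A -> b \in A -> forall i : 'I_l, (i < j)%N -> a i = b i
      & \sum_(a in A) c a *: \prod_(i < l | (j <= i)%N) f i ^+ a i \in q j].
  elim: j => [_|j IHj jl].
    exists [set a | c a != 0]; split.
    - by apply/set0Pn; exists a1; rewrite inE.
    - by move=> a; rewrite inE.
    - by [].
    - rewrite (bigID (fun a => c a != 0)) /= in sum_q.
      rewrite [X in _ + X]big1 ?addr0 in sum_q; last first.
        by move=> a; rewrite negbK => /eqP->; rewrite scale0r.
      rewrite (eq_bigl (fun a => c a != 0)) //; last by move=> a; rewrite inE.
  have [A [/set0Pn[a2 a2A] Ac Aeq sumA]] := IHj (ltnW jl).
  pose o := Ordinal jl.
  have [a0 a0A a0_min] := arg_minnP (fun a : {ffun 'I_l -> 'I_D} => val (a o)) a2A.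
  have qj := q_prime _ (ltnW jl); have qj1 := q_prime _ jl.
  pose G (a : {ffun 'I_l -> 'I_D}) := \prod_(i < l | (j < i)%N) f i ^+ a i.
  have prodE (a : {ffun 'I_l -> 'I_D}) :
      \prod_(i < l | (j <= i)%N) f i ^+ a i = f o ^+ a o * G a.
    rewrite (bigD1 o) //=; congr (_ * _); apply: eq_bigl => i.
    by rewrite ltn_neqAle eq_sym andbC.
  have : \sum_(a in A) c a *: (f o ^+ (a o - a0 o) * G a) \in q j.
    apply: (prime_idealX_cancel qj (n := a0 o) (fNq o)).
    move: sumA; congr (_ \in q j); rewrite mulr_sumr; apply: eq_bigr => a aA.
    by rewrite prodE -scalerAr mulrA -exprD subnKC ?a0_min.
  move/(q_sub _ jl).
  rewrite (bigID (fun a : {ffun 'I_l -> 'I_D} => a o == a0 o)) /= => sumq.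
  have {}sumq : \sum_(a in A | a o == a0 o)
      c a *: (f o ^+ (a o - a0 o) * G a) \in q j.+1.
    rewrite -[X in X \in _](addrK (\sum_(a in A | a o != a0 o)
      c a *: (f o ^+ (a o - a0 o) * G a))).
    apply: (prime_idealB qj1 sumq); apply: prime_ideal_sum => // a /andP[aA nao].
    have : (0 < a o - a0 o)%N by rewrite subn_gt0 ltn_neqAle eq_sym nao a0_min.
    case: (_ - _)%N => // u _; rewrite exprSr -mulrA mulrCA mulrC scalerAl.
    exact: (prime_idealMl qj1 _ (fq o)).
  exists [set a in A | a o == a0 o]; split.
  - by apply/set0Pn; exists a0; rewrite inE eqxx andbT.
  - by move=> a; rewrite inE => /andP[/Ac].
  - move=> a b; rewrite !inE => /andP[aA /eqP ao] /andP[bA /eqP bo] i.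
    rewrite ltnS leq_eqVlt => /predU1P[ij|]; last exact: Aeq.
    by have -> : i = o; [exact: val_inj | rewrite ao bo].
  - move: sumq; congr (_ \in q j.+1); apply: eq_big => [a|a /andP[_ /eqP->]].
      by rewrite inE.
    by rewrite subnn mul1r.
have [A [/set0Pn[a aA] Ac Aeq]] := step l (leqnn l).
(* All exponents now agree, so one monomial is left; its remaining product is empty and the unit
   [c a] lies in [q l]. *)
have -> : A = [set a].
  apply/setP => b; rewrite inE; apply/idP/eqP => [bA|->//].
  by apply/ffunP => i; apply: Aeq.
rewrite big_set1 big_pred0; last by move=> i; rewrite leqNgt ltn_ord.
move/(prime_idealMl (q_prime _ (leqnn l)) (c a)^-1%:A).
by rewrite mulr_algl scalerA mulVf ?Ac // scale1r; apply/negP/prime_ideal1/q_prime.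
Qed.

(** [msize] is the degree plus one, and 0 for the zero polynomial; bounding it by a successor makes
    degree bounds additive without excluding zero. *)
Lemma msizeM_leS (k : fieldType) (n a b : nat) (p q : {mpoly k[n]}) :
  (msize p <= a.+1)%N -> (msize q <= b.+1)%N -> (msize (p * q) <= (a + b).+1)%N.
Proof.
move=> pa qb; have [->|p0] := eqVneq p 0; first by rewrite mul0r msize0.
have [->|q0] := eqVneq q 0; first by rewrite mulr0 msize0.
by rewrite msizeM //; move: (msize p) (msize q) pa qb => u v; lia.
Qed.

Lemma msize_prod_leS (k : fieldType) (n : nat) (I : Type) (s : seq I)
    (F : I -> {mpoly k[n]}) (e : I -> nat) :
  (forall i, msize (F i) <= (e i).+1)%N ->
  (msize (\prod_(i <- s) F i) <= (\sum_(i <- s) e i).+1)%N.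
Proof.
move=> Fe; elim: s => [|i s IHs]; first by rewrite !big_nil msize1.
by rewrite !big_cons msizeM_leS.
Qed.

Lemma msize_exp_leS (k : fieldType) (n d m : nat) (p : {mpoly k[n]}) :
  (msize p <= d.+1)%N -> (msize (p ^+ m) <= (m * d).+1)%N.
Proof.
move=> pd; elim: m => [|m IHm]; first by rewrite expr0 msize1.
by rewrite exprS mulSn msizeM_leS.
Qed.

(* The D^l monomials of degree < D in each f_i lie in the span of the M^n
   monomials of degree < M in each variable, where M grows linearly in D. *)
Lemma mpoly_algebraic_dependence (k : fieldType) (n l : nat)
    (f : 'I_l -> {mpoly k[n]}) : (n < l)%N ->
  exists D (c : {ffun 'I_l -> 'I_D} -> k),
    (exists a, c a != 0) /\ \sum_a c a *: \prod_i f i ^+ a i = 0.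
Proof.
move=> nl; pose d := \max_i msize (f i).
have fd i : (msize (f i) <= d.+1)%N by apply/leqW/(leq_bigmax i).
(* With this [D], [M ^ n <= D ^ n * (l * d).+1 ^ n < D ^ n * D <= D ^ l], the last step because
   [n < l]. *)
pose D := ((l * d).+1 ^ n).+1; pose M := (l * (D * d)).+1.
pose E := {ffun 'I_l -> 'I_D}; pose E' := {ffun 'I_n -> 'I_M}.
pose F (a : E) := \prod_i f i ^+ a i.
pose mon (b : E') : 'X_{1..n} := [multinom (b i : nat) | i < n].
pose A := \matrix_(i < #|E|, j < #|E'|) (F (enum_val i))@_(mon (enum_val j)).
have card_lt : (#|E'| < #|E|)%N.
  rewrite !card_ffun !card_ord.
  apply: (@leq_ltn_trans ((D * (l * d).+1) ^ n)%N).
    have MD : (M <= D * (l * d).+1)%N by rewrite /M; lia.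
    by case: (n) => // n'; rewrite leq_exp2r.
  rewrite expnMn; apply: (@leq_trans (D ^ n * D)); last by rewrite -expnSr leq_pexp2l.
  by rewrite ltn_pmul2l ?expn_gt0.
(* [A] has more rows than columns; a nonzero vector of its left kernel supplies the coefficients of
   the relation. *)
have : kermx A != 0.
  by rewrite -mxrank_eq0 mxrank_ker subn_eq0 -ltnNge (leq_ltn_trans (rank_leq_col A)).
case/rowV0Pn => v /sub_kermxP vA v0.
exists D, (fun a => v 0 (enum_rank a)); split.
  have /rV0Pn[i vi] := v0; exists (enum_val i); by rewrite enum_valK.
apply/mpolyP => m; rewrite mcoeff0 linear_sum /=.
(* A monomial with some exponent at least [M] has degree above that of every [F a], so its
   coefficient vanishes; the columns of [A] cover all others. *)
have [/forallP mM|/forallPn[i]] := boolP [forall i, m i < M]%N; last first.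
  rewrite -leqNgt => Mm; apply: big1 => a _; rewrite mcoeffZ.
  rewrite memN_msupp_eq0 ?mulr0 //; apply: msize_mdeg_ge.
  apply: (@leq_trans (m i)); last first.
    by rewrite mdegE (bigD1 i) //= leq_addr.
  apply: leq_trans Mm; rewrite /M.
  apply: leq_trans (msize_prod_leS _ (fun i => msize_exp_leS _ (fd i))) _.
  rewrite ltnS -[l in (l * _)%N]card_ord -sum_nat_const.
  by apply: leq_sum => j _; apply: leq_mul (ltnW (ltn_ord (a j))) (leqnn d).
have /rowP/(_ (enum_rank [ffun i => Ordinal (mM i)])) := vA.
rewrite !mxE => vA0; rewrite -[RHS]vA0 (reindex (@enum_val _ E)) /=; last first.
  exact/onW_bij/enum_val_bij.
apply: eq_bigr => i _; rewrite !mxE mcoeffZ enum_valK enum_rankK.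
congr (_ * _@__); apply/mnmP => j; by rewrite mnmE ffunE.
Qed.

Lemma mpoly_krull_dimension (k : fieldType) (n : nat)
    (p : {pred {mpoly k[n]}}) (h : nat) : prime_chain_below p h -> (h <= n)%N.
Proof.
case=> q [q_prime q_strict _]; rewrite leqNgt; apply/negP => nh.
have /fin_all_exists2[f fNq fq] (i : 'I_h) :
    exists2 f, f \notin q i & f \in q i.+1.
  have [_ strict] := q_strict i (ltn_ord i).
  have [f /(imply_to_and (f \in q i.+1)) [fq fNq]] := not_all_ex_not _ _ strict.
  by exists f => //; apply/negP.
have [D [c [[a ca] sum0]]] := mpoly_algebraic_dependence f nh.
move/eqP: ca; apply; apply: (prime_chain_independent q_prime) fNq fq _ a.
  by move=> i /q_strict[].
by rewrite sum0; apply/prime_ideal0/q_prime.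
Qed.

(** * Primes generated by variables *)

Section VariablePrimes.
Variables (k : fieldType) (n : nat).
Implicit Types (A B : {set 'I_n}) (f : {mpoly k[n]}).

Definition kill A : {mpoly k[n]} -> {mpoly k[n]} :=
  comp_mpoly [tuple if i \in A then 0 else 'X_i | i < n].

(** The ideal generated by the variables in [A], encoded as the kernel of a substitution into a
    domain: primality is immediate and membership boolean. *)
Definition var_prime A : {pred {mpoly k[n]}} := [pred f | kill A f == 0].

Lemma killX A i : kill A 'X_i = if i \in A then 0 else 'X_i.
Proof. by rewrite /kill comp_mpolyXU -tnth_nth tnth_mktuple. Qed.

Lemma killD A : {morph kill A : f g / f + g}.
Proof. exact: comp_mpolyD. Qed.

Lemma killM A : {morph kill A : f g / f * g}.
Proof. exact: rmorphM. Qed.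

Lemma killC A c : kill A c%:MP = c%:MP.
Proof. exact: comp_mpolyC. Qed.

Lemma var_prime_prime A : prime_ideal (var_prime A).
Proof.
split; [split | ].
- by rewrite inE -mpolyC0 killC.
- by rewrite inE -mpolyC1 killC mpolyC1 oner_eq0.
- move=> a f g; rewrite !inE killD killM => /eqP-> /eqP->.
  by rewrite mulr0 addr0.
- by move=> f g; rewrite !inE killM mulf_eq0.
Qed.

Lemma mem_var_prime A i : ('X_i \in var_prime A) = (i \in A).
Proof.
rewrite inE killX; case: ifP => _; rewrite ?eqxx //.
by rewrite -msize_poly_eq0 msizeX.
Qed.

(** Every polynomial is congruent to its image under [kill A] modulo [p]: this holds for constants
    and variables and is stable under sums and products. *)
Lemma var_prime_sub A (p : {pred {mpoly k[n]}}) :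
  prime_ideal p -> (forall i, i \in A -> 'X_i \in p) -> {subset var_prime A <= p}.
Proof.
move=> pp pA f; rewrite inE => /eqP kf.
pose S := fun g : {mpoly k[n]} => g - kill A g \in p.
have SM g h : S g -> S h -> S (g * h).
  rewrite /S killM => Sg Sh.
  have -> : g * h - kill A g * kill A h =
      h * (g - kill A g) + kill A g * (h - kill A h).
    by rewrite !mulrBr addrA (mulrC h g) (mulrC h) subrK.
  by apply: (prime_idealD pp); apply: (prime_idealMl pp).
have SC c : S c%:MP by rewrite /S killC subrr (prime_ideal0 pp).
suff : S f by rewrite /S kf subr0.
elim/mpolyind: f {kf} => [|c m f _ _ Sf]; first by rewrite -mpolyC0.
rewrite /S killD opprD addrACA; apply: (prime_idealD pp) => //.
rewrite -mul_mpolyC; apply: (SM) => //.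
rewrite mpolyXE_id; apply: (big_ind S) => [||i _].
- by rewrite -mpolyC1.
- exact: SM.
- elim: (m i) => [|e IHe]; first by rewrite expr0 -mpolyC1.
  rewrite exprS; apply: SM IHe; rewrite /S killX.
  by case: ifP => [/pA|_]; rewrite ?subr0 // subrr (prime_ideal0 pp).
Qed.

Lemma var_primeS A B : A \subset B -> {subset var_prime A <= var_prime B}.
Proof.
move=> /subsetP AB; apply: var_prime_sub (var_prime_prime B) _ => i /AB.
by rewrite mem_var_prime.
Qed.

Lemma var_prime_proper A B : A \proper B ->
  {subset var_prime A <= var_prime B} /\ ~ {subset var_prime B <= var_prime A}.
Proof.
case/properP => AB [i iB iNA]; split; first exact: var_primeS.
by move/(_ 'X_i); rewrite !mem_var_prime iB (negPf iNA) => /(_ isT).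
Qed.

Lemma prime_chain_below_vars A (p : {pred {mpoly k[n]}}) :
  prime_ideal p -> (forall i, i \in A -> 'X_i \in p) ->
  prime_chain_below p #|A|.
Proof.
move=> pp pA; pose T j := [set i in take j (enum A)].
have TS j : (j < #|A|)%N -> T j \proper T j.+1.
  rewrite cardE => jA; apply/properP.
  have [i0 _] : exists i, i \in A.
    by apply/card_gt0P; rewrite cardE (leq_ltn_trans _ jA).
  rewrite /T (take_nth i0 jA); split.
    by apply/subsetP => i; rewrite !inE mem_rcons inE orbC => ->.
  exists (nth i0 (enum A) j); first by rewrite inE mem_rcons mem_head.
  by rewrite inE in_take ?mem_nth // index_uniq ?enum_uniq ?ltnn.
have TA j : T j \subset A.
  by apply/subsetP => i; rewrite inE => /mem_take; rewrite mem_enum.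
have Tp j : {subset var_prime (T j) <= p}.
  by apply: var_prime_sub => // i /(subsetP (TA j))/pA.
(* The top of the chain is [p] itself, possibly larger than [var_prime A]; the last inclusion is
   strict because of the last variable of [A]. *)
exists (fun j => if (j < #|A|)%N then var_prime (T j) else p); split.
- by move=> j _; case: ifP => _ //; apply: var_prime_prime.
- move=> j jA; rewrite jA; case: ltnP => [_|Aj]; first exact/var_prime_proper/TS.
  split=> // pT; have [_ [i iT iNT]] := properP (TS j jA).
  have := pT 'X_i (pA i (subsetP (TA j.+1) i iT)); rewrite mem_var_prime.
  by apply/negP.
- by rewrite ltnn.
Qed.

(* A chain ending at var_prime A can be prolonged by adding the variables outside
   A one at a time. *)
Lemma var_prime_height A : prime_height (var_prime A) #|A|.
Proof.
split.
  by apply: prime_chain_below_vars (var_prime_prime A) _ => i; rewrite mem_var_prime.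
have [N] := ubnP #|~: A|; elim: N A => // N IHN A AN h hA.
have [A0|/set0Pn[i iA]] := eqVneq (~: A) set0.
  have := mpoly_krull_dimension hA.
  by rewrite -[A]setCK A0 setC0 cardsT card_ord.
have AiA : A \proper i |: A.
  by rewrite properE subsetU1 subUset sub1set subxx andbT -in_setC.
rewrite inE in iA.
have cAi : #|i |: A| = #|A|.+1 by rewrite cardsU1 iA.
rewrite -ltnS -cAi; apply: (IHN (i |: A)).
  by have := cardsC A; have := cardsC (i |: A); lia.
case: hA => q [q_prime q_strict q_top].
exists (fun j => if (j <= h)%N then q j else var_prime (i |: A)); split.
- by move=> j _; case: ifP => [/q_prime|_] //; apply: var_prime_prime.
- move=> j; rewrite ltnS => jh; rewrite jh; case: ltnP => [/q_strict//|hj].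
  have -> : j = h by apply/eqP; rewrite eqn_leq jh.
  have [sub nsub] := var_prime_proper AiA; split.
    by move=> f; rewrite q_top; apply: sub.
  by move=> s; apply: nsub => f /s; rewrite q_top.
- by rewrite ltnn.
Qed.

End VariablePrimes.

(** * Heights of path ideals from hitting sets *)

Lemma path_ideal_height (k : fieldType) (d : Order.disp_t)
    (P : finPOrderType d) (t h : nat) :
  (exists H : {set P}, (#|H| <= h)%N /\
     forall s, size s = t -> saturated_chain s -> has (mem H) s) ->
  (forall H : {set P},
     (forall s, size s = t -> saturated_chain s -> has (mem H) s) ->
     (h <= #|H|)%N) ->
  height (@path_ideal k d P t) h.
Proof.
move=> [H [Hh Hs]] hmin; have {}Hh : #|H| = h by apply/eqP; rewrite eqn_leq Hh hmin.
have cardH (K : {set P}) : #|enum_rank @: K| = #|K|.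
  exact/card_imset/enum_rank_inj.
split.
  exists (var_prime (enum_rank @: H)); split; last first.
    by rewrite -[X in prime_height _ X]Hh -cardH; apply: var_prime_height.
  have pH := @var_prime_prime k _ (enum_rank @: H).
  split=> // _ [l [a [g [gen ->]]]].
  apply: (prime_ideal_sum pH) => i _; apply: (prime_idealMl pH).
  have [s [st sc ->]] := gen i; have /hasP[x xs xH] := Hs s st sc.
  rewrite (big_rem x) //= mulrC; apply: (prime_idealMl pH).
  by rewrite mem_var_prime imset_f.
move=> p [pp Ip]; pose K := [set x | var k x \in p].
(* Since [p] is prime, [K] meets every path. Exactly [h] of its elements are kept, to get a chain of
   length [h]. *)
have /card_geqP[s [us hs sK]] : (h <= #|K|)%N.
  apply: hmin => s st sc; apply/hasP.
  have [|x xs px] := prime_ideal_prod pp (s := s) (F := @var k d P).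
    apply: Ip; exists 1%N, (fun=> 1), (fun=> \prod_(x <- s) var k x).
    by split; [exists s | rewrite big_ord1 mul1r].
  by exists x; rewrite //= inE.
have := @prime_chain_below_vars _ _ [set enum_rank x | x in s] p pp.
rewrite (card_imset _ enum_rank_inj) (card_uniqP us) hs; apply => _ /imsetP[x xs ->].
by have := sK x xs; rewrite inE.
Qed.

Local Close Scope ring_scope.

(** * Hitting sets of the paths in a cycle poset *)

Section Chains.
Variables (d : Order.disp_t) (P : finPOrderType d).
Implicit Types (x y z : P) (s c : seq P) (H : {set P}).

Lemma saturated_chain_lt s : saturated_chain s -> sorted <%O s.
Proof. by apply: sub_sorted => x y /andP[]. Qed.

Lemma saturated_chain_uniq s : saturated_chain s -> uniq s.
Proof. by move/saturated_chain_lt/lt_sorted_uniq. Qed.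

(** A chain that is not maximal lies in a strictly longer one, and lengths are bounded by [#|P|]. *)
Lemma maximal_saturated_chain_extends s : saturated_chain s ->
  exists2 c, maximal_saturated_chain c & {subset s <= c}.
Proof.
have [N] := ubnP (#|P| - size s); elim: N s => // N IHN s sN sc.
case: (classic (maximal_saturated_chain s)) => [sm|nsm]; first by exists s.
have /not_all_ex_not[s' ns'] : ~ forall s', saturated_chain s' ->
  {subset s <= s'} -> s' = s by move=> smax; apply: nsm.
have [sc' nsub] := imply_to_and _ _ ns'.
have [sub neq] := imply_to_and _ _ nsub.
(* Otherwise [s'] has the same elements as [s], and sorted sequences with the same elements are
   equal. *)
have lt_size : size s < size s'.
  rewrite ltnNge; apply/negP => le_size; apply: neq.
  have [_ eqm] := uniq_min_size (saturated_chain_uniq sc) sub le_size.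
  by apply: lt_sorted_eq => [||x]; rewrite ?saturated_chain_lt ?eqm.
have sz : size s' <= #|P|.
  by rewrite -(card_uniqP (saturated_chain_uniq sc')) max_card.
have [|c cm s'c] := IHN s' _ sc'; first by lia.
by exists c => // x /sub/s'c.
Qed.

(* Two consecutive elements of s are consecutive in c, so the indices in c of t
   consecutive elements of s run through all residues modulo t. *)
Lemma saturated_subchain_hit s c t x0 : saturated_chain s -> saturated_chain c ->
  {subset s <= c} -> size s = t -> 0 < t ->
  exists2 j, j < size c %/ t & nth x0 c (j * t + t.-1) \in s.
Proof.
move=> ss cs sub st t0.
have clt := saturated_chain_lt cs.
have idx i : i < t -> index (nth x0 s i) c = index (nth x0 s 0) c + i.
  elim: i => [|i IHi it]; first by rewrite addn0.
  have [it' si si1] : [/\ i < t, nth x0 s i \in c & nth x0 s i.+1 \in c].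
    by split; rewrite ?(ltnW it) // sub // mem_nth ?st // ltnW.
  have /andP[lt_i /forallP no_mid] : covers (nth x0 s i) (nth x0 s i.+1).
    by have /(sortedP x0)/(_ i) := ss; rewrite st; apply.
  have mono := lt_sorted_ltn_nth x0 clt; rewrite addnS -IHi //.
  set a := index (nth x0 s i) c; set b := index (nth x0 s i.+1) c.
  have [ac bc] : a < size c /\ b < size c by rewrite !index_mem.
  have ab : a < b by rewrite -mono ?inE // !nth_index.
  apply/eqP; rewrite eqn_leq ab andbT leqNgt; apply/negP => a1b.
  (* If the indices were not adjacent, this element would lie strictly between two elements related
     by a cover. *)
  have := no_mid (nth x0 c a.+1); rewrite -[nth x0 s i](nth_index x0 si).
  rewrite -[nth x0 s i.+1](nth_index x0 si1) !mono ?inE ?(ltn_trans a1b bc) //.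
  by rewrite leqnn a1b.
set a := index (nth x0 s 0) c in idx.
(* The offset that brings the index in [c] to residue [t.-1]; indices start at 0, so these are the
   positions divisible by [t]. *)
pose i := t.-1 - a %% t; have at_lt := ltn_pmod a t0.
have it : i < t by rewrite /i; lia.
have ai : a + i = (a %/ t) * t + t.-1.
  by rewrite [in LHS](divn_eq a t) /i; lia.
have aic : a + i < size c by rewrite -idx // index_mem sub // mem_nth ?st.
exists (a %/ t).
  by rewrite leq_divRL // mulSn; lia.
by rewrite -ai -idx // nth_index ?mem_nth ?st // sub // mem_nth ?st.
Qed.

(** Cut [c] into consecutive blocks of [t] elements; each full block is a path and contains an
    element of [H]. *)
Lemma count_hits H t c : 0 < t -> saturated_chain c ->
  (forall s, size s = t -> saturated_chain s -> has (mem H) s) ->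
  size c %/ t <= count (mem H) c.
Proof.
move=> t0 + Hhit; have [N] := ubnP (size c); elim: N c => // N IHN c cN cs.
have [ct|tc] := ltnP (size c) t; first by rewrite divn_small.
rewrite -[c in count _ c](cat_take_drop t) count_cat.
have : 0 < count (mem H) (take t c).
  by rewrite -has_count Hhit ?size_takel //; apply: take_sorted.
have := IHN (drop t c); rewrite size_drop => /(_ _ (drop_sorted _ cs)).
have -> : size c %/ t = (size c - t) %/ t + 1.
  by rewrite -[in LHS](subnK tc) divnDr // divnn t0.
by lia.
Qed.

Section CyclePoset.
Variables (m r t : nat).
Hypotheses (ht : 1 < t) (hP : cycle_poset P m r).

Let bound := if (t %| m) && (t %| r) then (m + r) %/ t - 1 else m %/ t + r %/ t.

Let boundE : bound = m %/ t + r %/ t - ((t %| m) && (t %| r)).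
Proof. by rewrite /bound; case: ifP => [/andP[tm tr]|_]; rewrite ?subn0 ?divnDl. Qed.

Lemma cycle_poset_hitting_lb H :
  (forall s, size s = t -> saturated_chain s -> has (mem H) s) -> bound <= #|H|.
Proof.
move=> Hhit; have t0 : 0 < t by lia.
have [b [e [s1 [s2 [[c1m c2r] dis cmax _]]]]] := hP.
have sat c : c = b :: rcons s1 e \/ c = b :: rcons s2 e -> saturated_chain c.
  by case/cmax.
have c1 := sat _ (or_introl erefl); have c2 := sat _ (or_intror erefl).
have u1 := saturated_chain_uniq c1; have u2 := saturated_chain_uniq c2.
have tail c : saturated_chain (b :: rcons c e) ->
    [/\ saturated_chain (b :: c), saturated_chain (rcons c e) & saturated_chain c].
  move=> sc; have sc' : saturated_chain (b :: c).
    by move: sc; rewrite -rcons_cons -cats1 => /cat_sorted2[].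
  by split => //; [exact: (path_sorted sc) | exact: (path_sorted sc')].
have [bs1 s1e ss1] := tail _ c1; have [bs2 s2e ss2] := tail _ c2.
have hits c (sc : saturated_chain c) := count_hits t0 sc Hhit.
have := hits _ c1; have := hits _ bs1; have := hits _ s1e; have := hits _ ss1.
have := hits _ c2; have := hits _ bs2; have := hits _ s2e; have := hits _ ss2.
(* The interiors are disjoint and avoid the end points, so nothing is counted twice. *)
have : (b \in H) + (e \in H) + count (mem H) s1 + count (mem H) s2 <= #|H|.
  have u : uniq (b :: e :: s1 ++ s2).
    move: u1 u2; rewrite !cons_uniq !rcons_uniq cat_uniq.
    rewrite !(inE, mem_rcons, mem_cat) !negb_or.
    case/and3P=> /andP[be bs1'] es1 us1 /and3P[/andP[_ bs2'] es2 us2].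
    by rewrite be bs1' bs2' es1 es2 us1 us2 dis.
  have : [seq x <- b :: e :: s1 ++ s2 | x \in H] \subset H.
    by apply/subsetP => x; rewrite mem_filter => /andP[].
  move/subset_leq_card; rewrite (card_uniqP (filter_uniq _ u)) size_filter /=.
  by rewrite count_cat !addnA.
rewrite boundE /= -!cats1 !size_cat !count_cat /= !addn0 -c1m -c2r /= !size_rcons.
rewrite !addn1.
set h1 := count _ s1; set h2 := count _ s2; set n1 := size s1; set n2 := size s2.
(* As [t > 1] divides no two consecutive numbers, removing both ends of a chain lowers its quotient
   by at most one. This settles the case where both ends lie in [H]. *)
have excl n : (t %| n.+1) && (t %| n.+2) = false.
  apply/negP => /andP[t1 t2]; have := dvdn_sub t2 t1.
  by rewrite subSnn dvdn1 gtn_eqF.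
have := excl n1; have := excl n2; rewrite !divnS //.
move: (t %| n1.+1) (t %| n1.+2) (t %| n2.+1) (t %| n2.+2) (b \in H) (e \in H).
move: #|H| (n1 %/ t) (n2 %/ t) h1 h2; clear.
by move=> ? ? ? ? ? [] [] [] [] [] [] //=; lia.
Qed.

Lemma cycle_poset_hitting_ub : exists H : {set P}, #|H| <= bound /\
  forall s, size s = t -> saturated_chain s -> has (mem H) s.
Proof.
have t0 : 0 < t by lia.
have [b [e [s1 [s2 [[c1m c2r] dis cmax _]]]]] := hP.
pose mult c := [set nth b c (j * t + t.-1) | j : 'I_(size c %/ t)].
exists (mult (b :: rcons s1 e) :|: mult (b :: rcons s2 e)); split.
  have card_mult c : #|mult c| <= size c %/ t.
    by rewrite (leq_trans (leq_imset_card _ _)) ?card_ord.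
  (* When [t] divides the length, the last selected position is that of the maximum [e]. *)
  have e_mult s : t %| size (b :: rcons s e) -> e \in mult (b :: rcons s e).
    set c := b :: rcons s e => tc.
    have c0 : 0 < size c %/ t by rewrite divn_gt0 // dvdn_leq.
    apply/imsetP; have j_lt : (size c %/ t).-1 < size c %/ t by rewrite prednK.
    exists (Ordinal j_lt) => //=.
    have -> : (size c %/ t).-1 * t + t.-1 = (size c).-1.
      rewrite -[in RHS](divnK tc); case: (_ %/ t) c0 => // u _.
      by rewrite mulSn /=; lia.
    by rewrite nth_last /c /= last_rcons.
  (* If [t] divides both lengths, the two sets share [e], and inclusion-exclusion saves one
     element. *)
  have := cardsUI (mult (b :: rcons s1 e)) (mult (b :: rcons s2 e)).
  have := card_mult (b :: rcons s1 e); have := card_mult (b :: rcons s2 e).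
  rewrite boundE c1m c2r; case: andP => [[tm tr]|_]; last by lia.
  have : 0 < #|mult (b :: rcons s1 e) :&: mult (b :: rcons s2 e)|.
    by apply/card_gt0P; exists e; rewrite inE !e_mult ?c1m ?c2r.
  lia.
move=> s st ss; have [c cM sub] := maximal_saturated_chain_extends ss.
have [j jc js] := saturated_subchain_hit b ss (proj1 cM) sub st t0.
apply/hasP; exists (nth b c (j * t + t.-1)) => //=.
have jm : nth b c (j * t + t.-1) \in mult c by apply/imsetP; exists (Ordinal jc).
by have [<-|<-] := (cmax c).1 cM; rewrite inE jm ?orbT.
Qed.

End CyclePoset.
End Chains.

Theorem proposition4p14 (k : fieldType) (d : Order.disp_t)
    (P : finPOrderType d) (m r t : nat)
    (hm : 2 <= m) (hr : 2 <= r) (ht : 2 <= t) (hP : cycle_poset P m r) :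
  height (@path_ideal k d P t)
    (if (t %| m) && (t %| r) then (m + r) %/ t - 1 else m %/ t + r %/ t).
Proof.
apply: path_ideal_height; first exact: cycle_poset_hitting_ub.
exact: cycle_poset_hitting_lb.
Qed.
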